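(* Let $a(n),b(n),c(n)$ be real polynomials in $n$ of the same degree $\delta$ with positive leading coefficients, taking positive values for all integers $n\ge 1$. Let $(u_n)_{n\ge 0}$ be a sequence of real numbers satisfying $$a(n)u_{n+1}=b(n)u_n-c(n)u_{n-1},\qquad n=1,2,\ldots.$$ Then $u_n>0$ for all $n\ge 0$ if and only if $u_0>0$ and the infinite tridiagonal matrix $$M_0=\begin{pmatrix} u_1 & c(1) & & & \\ u_0 & b(1) & c(2) & & \\ & a(1) & b(2) & c(3) & \\ & & a(2) & b(3) & \ddots\\ & & & \ddots & \ddots \end{pmatrix}$$ (with all unspecified entries equal to $0$) is totally nonnegative.
   Context: A (finite or infinite) matrix is totally nonnegative if all of its minors (determinants of finite square submatrices, of all orders) are nonnegative. *)

(* Defs.v *)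
From HB Require Import structures.
From mathcomp Require Import all_boot all_order all_algebra.
From mathcomp Require Import reals.

Set Implicit Arguments.
Unset Strict Implicit.
Unset Printing Implicit Defensive.

Import Order.TTheory GRing.Theory Num.Theory.
Local Open Scope ring_scope.

(* Infinite matrices are functions M : nat -> nat -> R, with rows and columns
   indexed from 0. A minor of order k is given by strictly increasing row and
   column selections f and g. *)
Definition infinite_minor (R : realType) (M : nat -> nat -> R) (k : nat)
    (f g : 'I_k -> nat) : R :=
  \det (\matrix_(i < k, j < k) M (f i) (g j)).

Definition totally_nonnegative (R : realType) (M : nat -> nat -> R) : Prop :=
  forall (k : nat) (f g : 'I_k -> nat),
    {homo f : i j / (i < j)%N} -> {homo g : i j / (i < j)%N} ->
    0 <= infinite_minor M f g.

Definition tridiagonal (R : realType) (sub diag super : nat -> R) :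
    nat -> nat -> R :=
  fun i j =>
    if i == j.+1 then sub j
    else if i == j then diag i
    else if j == i.+1 then super i
    else 0.

(* The first column (u_1, u_0, 0, ...) does not follow the pattern of the
   later columns (..., c(j), b(j), a(j), ...), j >= 1. *)
Definition M0 (R : realType) (a b c : {poly R}) (u : nat -> R) :
    nat -> nat -> R :=
  tridiagonal
    (fun j => if j is 0%N then u 0%N else a.[j%:R])
    (fun i => if i is 0%N then u 1%N else b.[i%:R])
    (fun i => c.[i.+1%:R]).

(* Main.v *)
(** The leading principal minor of order [n+1] of [M0] is
    [a(1) ... a(n) u_(n+1)], since both sides obey the recurrence for
    tridiagonal determinants.  Hence total nonnegativity gives [u_n >= 0], and a
    first zero [u_n = 0] would force [u_(n+1) < 0].

    Conversely, if [u] is positive then so are all these minors, so [M0] factors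
    as (lower bidiagonal) x (diagonal) x (upper bidiagonal) with nonnegative
    factors.  Multiplying by a bidiagonal factor adds to each row a nonnegative
    multiple of the previous one, which preserves total nonnegativity: expanding
    a minor by multilinearity gives a nonnegative combination of minors with
    weakly increasing rows, and those with a repeated row vanish. *)

Require Import Defs.
From HB Require Import structures.
From mathcomp Require Import all_boot all_order all_algebra.
From mathcomp Require Import reals.

Set Implicit Arguments.
Unset Strict Implicit.
Unset Printing Implicit Defensive.

Import Order.TTheory GRing.Theory Num.Theory.
Local Open Scope ring_scope.

(** Left multiplication by the unit lower bidiagonal matrix with subdiagonal [l], written entrywise
    to avoid infinite products. *)
Definition row_shear (R : realType) (l : nat -> R) (N : nat -> nat -> R) :
    nat -> nat -> R :=
  fun i j => N i j + (if i is i'.+1 then l i' * N i' j else 0).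

Lemma totally_nonnegative_eq (R : realType) (M N : nat -> nat -> R) :
  M =2 N -> totally_nonnegative N -> totally_nonnegative M.
Proof.
move=> eqMN tN k f g hf hg; rewrite /infinite_minor.
under eq_mx do rewrite eqMN.
exact: tN.
Qed.

Lemma totally_nonnegative_tr (R : realType) (M : nat -> nat -> R) :
  totally_nonnegative M -> totally_nonnegative (fun i j => M j i).
Proof.
move=> tM k f g hf hg; rewrite /infinite_minor -det_tr.
have -> : (\matrix_(i, j) M (g j) (f i))^T = \matrix_(i < k, j < k) M (g i) (f j).
  by apply/matrixP => i j; rewrite !mxE.
exact: tM.
Qed.

Lemma det_zero_row (R : comNzRingType) (k : nat) (A : 'M[R]_k) (i : 'I_k) :
  (forall j, A i j = 0) -> \det A = 0.
Proof. by move=> A0; rewrite (expand_det_row A i) big1 // => j _; rewrite A0 mul0r. Qed.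

Lemma totally_nonnegative_diag (R : realType) (d : nat -> R) :
  (forall i, 0 <= d i) ->
  totally_nonnegative (fun i j => if i == j then d i else 0).
Proof.
move=> d_ge0 k f g hf hg; rewrite /infinite_minor.
(* At the first index where the selections differ, the row or the column with
   the smaller label vanishes. *)
have vanish (f' g' : 'I_k -> nat) (i : 'I_k) : {homo f' : i j / (i < j)%N} ->
    {homo g' : i j / (i < j)%N} -> (forall j : 'I_k, (j < i)%N -> f' j = g' j) ->
    (f' i < g' i)%N -> forall j, f' i != g' j.
  move=> hf' hg' eq_lt lt_i j; have [lt_ji|] := ltnP j i.
    by rewrite -(eq_lt j lt_ji) gtn_eqF // hf'.
  rewrite leq_eqVlt => /orP[/eqP/val_inj <-|lt_ij]; first by rewrite ltn_eqF.
  by rewrite ltn_eqF // (ltn_trans lt_i) // hg'.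
have [/forallP eq_fg|] := boolP [forall i, f i == g i].
  have -> : \matrix_(i, j) (if f i == g j then d (f i) else 0)
            = diag_mx (\row_(i < k) d (f i)).
    apply/matrixP => i j; rewrite !mxE -(eqP (eq_fg j)).
    have [<-|ne_ij] := eqVneq i j; first by rewrite eqxx.
    case: eqP => // eq_f; move: ne_ij; rewrite neq_ltn => /orP[] /hf;
      by rewrite eq_f ltnn.
  by rewrite det_diag prodr_ge0 // => i _; rewrite mxE.
rewrite negb_forall => /existsP[i0 ne_i0].
have [i ne_i min_i] := @arg_minnP _ i0 (fun i => f i != g i) val ne_i0.
have eq_lt (j : 'I_k) : (j < i)%N -> f j = g j.
  by move=> lt_ji; apply/eqP; apply: contraTT lt_ji => /min_i; rewrite -leqNgt.
case: (ltngtP (f i) (g i)) ne_i => // lt_i _.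
  rewrite (@det_zero_row _ _ _ i) // => j.
  by rewrite mxE (negPf (vanish f g i hf hg eq_lt lt_i j)).
rewrite -det_tr (@det_zero_row _ _ _ i) // => j.
rewrite !mxE eq_sym.
by rewrite (negPf (vanish g f i hg hf (fun j h => esym (eq_lt j h)) lt_i j)).
Qed.

Lemma totally_nonnegative_row_shear (R : realType) (l : nat -> R)
    (N : nat -> nat -> R) :
  (forall i, 0 <= l i) -> totally_nonnegative N ->
  totally_nonnegative (row_shear l N).
Proof.
move=> l_ge0 tN k f g hf hg; rewrite /infinite_minor.
(* In [A m h] the first [m] rows are already expanded, so that lowering row [m]
   onto its predecessor produces two equal rows. *)
pose A m (h : 'I_k -> nat) : 'M[R]_k := \matrix_(i, j)
  if (i < m)%N then N (h i) (g j) else row_shear l N (h i) (g j).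
(* Here [p] counts the rows still to be expanded; [h] is arbitrary because an expansion may lower a
   row label. *)
suff A_ge0 p m (h : 'I_k -> nat) : (m + p = k)%N -> {homo h : i j / (i < j)%N} ->
    0 <= \det (A m h).
  suff -> : \matrix_(i, j) row_shear l N (f i) (g j) = A 0%N f by apply: (A_ge0 k).
  by apply/matrixP => i j; rewrite !mxE.
elim: p m h => [|p IHp] m h.
  rewrite addn0 => -> hh.
  have -> : A k h = \matrix_(i, j) N (h i) (g j).
    by apply/matrixP => i j; rewrite !mxE ltn_ord.
  exact: tN.
rewrite addnS -addSn => eq_k hh.
have lt_mk : (m < k)%N by rewrite -eq_k leq_addr.
pose im := Ordinal lt_mk.
have IHh := IHp _ h eq_k hh.
have lt_ne (i : 'I_k) : i != im -> (i < m.+1)%N = (i < m)%N.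
  by move=> ne_i; rewrite ltnS leq_eqVlt (negPf (ne_i : val i != m)).
(* Row [0] has no predecessor, so the shear leaves it unchanged. *)
case h_m: (h im) => [|q].
  suff -> : A m h = A m.+1 h by [].
  apply/matrixP => i j; rewrite !mxE; have [->|/lt_ne->//] := eqVneq i im.
  by rewrite ltnn ltnSn h_m /row_shear addr0.
pose h' i := if i == im then q else h i.
have det_split : \det (A m h) = 1 * \det (A m.+1 h) + l q * \det (A m.+1 h').
  apply: (@determinant_multilinear _ _ _ _ _ im).
  - apply/rowP => j; rewrite !mxE ltnn ltnSn /h' eqxx h_m mul1r.
    by rewrite /row_shear.
  - apply/matrixP => i j; rewrite !mxE lt_ne //.
    by rewrite eq_sym neq_lift.
  apply/matrixP => i j; have ne_i : lift im i != im by rewrite eq_sym neq_lift.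
  by rewrite !mxE lt_ne // /h' (negPf ne_i).
rewrite det_split mul1r addr_ge0 // mulr_ge0 //.
(* If an earlier row already carries the label [q], two rows coincide and the determinant is
   zero. *)
have [/existsP[i /andP[lt_i /eqP eq_q]]|] :=
    boolP [exists i : 'I_k, (i < m)%N && (h i == q)].
  have ne_i : i != im by rewrite -val_eqE /= ltn_eqF.
  rewrite (@determinant_alternate _ _ _ _ _ ne_i) // => j.
  by rewrite !mxE lt_ne // lt_i ltnSn /h' (negPf ne_i) eqxx eq_q.
(* Otherwise the earlier labels, all at most [q], are below [q], and [h'] is still strictly
   increasing. *)
rewrite negb_exists => /forallP ne_q.
apply: IHp => // i j lt_ij; rewrite /h'.
have [eq_i|ne_i] := eqVneq i im; have [eq_j|ne_j] := eqVneq j im.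
- by move: lt_ij; rewrite eq_i eq_j ltnn.
- by rewrite -ltnS -h_m ltnW // -eq_i ltnS hh.
- have lt_im : (i < m)%N by rewrite eq_j in lt_ij.
  have := hh i im lt_im; rewrite h_m ltnS leq_eqVlt => /orP[eq_q|//].
  by have := ne_q i; rewrite lt_im eq_q.
- exact: hh.
Qed.

(* The hypotheses on [e] say that [e] is the sequence of pivots of Gaussian
   elimination. *)
Lemma totally_nonnegative_tridiagonal (R : realType)
    (sub diag super e : nat -> R) :
  (forall i, 0 <= sub i) -> (forall i, 0 <= super i) -> (forall i, 0 < e i) ->
  e 0%N = diag 0%N ->
  (forall i, diag i.+1 = e i.+1 + sub i / e i * super i) ->
  totally_nonnegative (tridiagonal sub diag super).
Proof.
move=> sub_ge0 super_ge0 e_gt0 e0 eS.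
pose D i j : R := if i == j then e i else 0.
(* The upper factor: [D] times a unit upper bidiagonal matrix, obtained by shearing the rows of the
   transpose, as [D] is symmetric. *)
pose U i j := row_shear (fun i => super i / e i) D j i.
have e_neq0 i : e i != 0 by rewrite gt_eqF.
have tU : totally_nonnegative U.
  apply: totally_nonnegative_tr; apply: totally_nonnegative_row_shear.
    by move=> i; rewrite divr_ge0 // ltW.
  by apply: totally_nonnegative_diag => i; rewrite ltW.
apply: (@totally_nonnegative_eq _ _ (row_shear (fun i => sub i / e i) U));
  last by apply: totally_nonnegative_row_shear => // i; rewrite divr_ge0 // ltW.
have UE i j : U i j = if i == j then e i else if j == i.+1 then super i else 0.
  rewrite /U /row_shear /D; case: j => [|j].
    by rewrite addr0 eq_sym; case: eqP => // <-.
  rewrite eqSS; have [->|_] := eqVneq i j.+1.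
    by rewrite ltn_eqF // mulr0 addr0.
  rewrite add0r.
  by case: (eqVneq j i) => [->|_]; rewrite ?mulr0 // divfK.
move=> i j; rewrite /tridiagonal /row_shear !UE; case: i => [|i].
  by rewrite addr0 (eq_sym 0%N j); case: j => [|j] //=; rewrite e0.
rewrite UE !eqSS.
have [->|_] := eqVneq i j.
  by rewrite gtn_eqF // ltn_eqF // add0r divfK.
have [_|_] := eqVneq i.+1 j.
  exact: eS.
by rewrite mulr0 addr0.
Qed.

Definition leading_minor (R : realType) (M : nat -> nat -> R) (n : nat) : R :=
  infinite_minor M (fun i : 'I_n => val i) (fun i : 'I_n => val i).

Lemma leading_minor_tridiagonal (R : realType) (sub diag super : nat -> R)
    (n : nat) (M := tridiagonal sub diag super) :
  leading_minor M n.+2 =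
  diag n.+1 * leading_minor M n.+1 - sub n * super n * leading_minor M n.
Proof.
have M_far i j : (i.+1 < j)%N || (j.+1 < i)%N -> M i j = 0.
  move=> far; rewrite /M /tridiagonal; have [eq_i|_] := eqVneq i j.+1.
    by move: far; rewrite eq_i ltnn orbF ltnNge -addn2 leq_addr.
  have [eq_i|_] := eqVneq i j; first by move: far; rewrite eq_i !ltnNge !leqnSn.
  have [eq_j|//] := eqVneq j i.+1.
  by move: far; rewrite eq_j ltnn ltnNge -addn2 leq_addr.
have M_sub i : M i.+1 i = sub i by rewrite /M /tridiagonal eqxx.
have M_diag i : M i i = diag i by rewrite /M /tridiagonal ltn_eqF // eqxx.
have M_super i : M i i.+1 = super i.
  by rewrite /M /tridiagonal ltn_eqF ?ltnS ?leqnSn // ltn_eqF // eqxx.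
(* Only the last two entries of the last row can be nonzero. *)
rewrite /leading_minor /infinite_minor (expand_det_row _ ord_max).
rewrite !big_ord_recr big1 /=; last first.
  by move=> j _; rewrite mxE M_far ?mul0r //= ltnS ltn_ord orbT.
rewrite !mxE /= M_sub M_diag addrC add0r /cofactor /= -signr_odd oddD addbb mul1r.
rewrite -signr_odd addSn oddS oddD addbb expr1 mulN1r mulrN -mulrA.
congr (_ * \det _ - _ * _).
  by apply/matrixP => i j; rewrite !mxE !lift_max.
(* In the minor left by the subdiagonal entry, the last column is zero except for [super n] at the
   bottom. *)
rewrite (expand_det_col _ ord_max) big_ord_recr big1 /=; last first.
  move=> i _; rewrite !mxE lift_max /= M_far ?mul0r //.
  by rewrite /bump leqnn add1n !ltnS ltn_ord.
rewrite !mxE lift_max /= /bump leqnn add1n M_super.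
rewrite add0r /cofactor /= -signr_odd oddD addbb mul1r.
congr (_ * \det _); apply/matrixP => i j; rewrite !mxE !lift_max /=.
by rewrite /bump [(n <= j)%N]leqNgt ltn_ord /= add0n leqNgt ltn_ord.
Qed.

Lemma leading_minor_ge0 (R : realType) (M : nat -> nat -> R) (n : nat) :
  totally_nonnegative M -> 0 <= leading_minor M n.
Proof. by move=> tM; apply: tM. Qed.

Lemma leading_minor_M0 (R : realType) (a b c : {poly R}) (u : nat -> R)
    (n : nat) :
  (forall n : nat, (1 <= n)%N ->
    a.[n%:R] * u n.+1 = b.[n%:R] * u n - c.[n%:R] * u n.-1) ->
  leading_minor (M0 a b c u) n.+1 = (\prod_(i < n) a.[i.+1%:R]) * u n.+1.
Proof.
move=> u_rec.
have minor0 : leading_minor (M0 a b c u) 0 = 1 by exact: det_mx00.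
have minor1 : leading_minor (M0 a b c u) 1 = u 1%N.
  by rewrite /leading_minor /infinite_minor det_mx11 mxE.
have minorS m := leading_minor_tridiagonal
  (fun j => if j is 0%N then u 0%N else a.[j%:R])
  (fun i => if i is 0%N then u 1%N else b.[i%:R]) (fun i => c.[i.+1%:R]) m.
(* The recurrence has order two, so the induction carries two consecutive minors. *)
suff [] : leading_minor (M0 a b c u) n.+1 = (\prod_(i < n) a.[i.+1%:R]) * u n.+1
    /\ leading_minor (M0 a b c u) n.+2
       = (\prod_(i < n.+1) a.[i.+1%:R]) * u n.+2 by [].
elim: n => [|n [IHn IHSn]]; (split; first by rewrite ?big_ord0 ?mul1r).
  rewrite [LHS]minorS -/(M0 a b c u) minor0 minor1 big_ord1 u_rec //.
  by rewrite mulr1 [u 0%N * _]mulrC.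
rewrite [LHS]minorS -/(M0 a b c u) IHn IHSn [in RHS]big_ord_recr /= -[in RHS]mulrA u_rec //.
rewrite mulrBr mulrCA; congr (_ - _).
rewrite big_ord_recr /=.
by rewrite -!mulrA [RHS]mulrCA; congr (_ * _); apply: mulrCA.
Qed.

Theorem theorem1p1 (R : realType) (delta : nat) (a b c : {poly R})
    (u : nat -> R)
    (size_a : size a = delta.+1) (size_b : size b = delta.+1)
    (size_c : size c = delta.+1)
    (lead_a : 0 < lead_coef a) (lead_b : 0 < lead_coef b)
    (lead_c : 0 < lead_coef c)
    (a_gt0 : forall n : nat, (1 <= n)%N -> 0 < a.[n%:R])
    (b_gt0 : forall n : nat, (1 <= n)%N -> 0 < b.[n%:R])
    (c_gt0 : forall n : nat, (1 <= n)%N -> 0 < c.[n%:R])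
    (u_rec : forall n : nat, (1 <= n)%N ->
      a.[n%:R] * u n.+1 = b.[n%:R] * u n - c.[n%:R] * u n.-1) :
  (forall n : nat, 0 < u n) <->
  (0 < u 0%N /\ totally_nonnegative (M0 a b c u)).
Proof.
split=> [u_gt0|[u0_gt0 tM]].
  split=> //.
  (* The pivots are the ratios of consecutive leading minors; the common factors [a(1) ... a(i-1)]
     cancel. *)
  pose e i := if i is 0%N then u 1%N else a.[i%:R] * u i.+1 / u i.
  apply: (@totally_nonnegative_tridiagonal _ _ _ _ e) => // [[|i]|i|[|i]|i].
  - exact: ltW.
  - by rewrite ltW // a_gt0.
  - by rewrite ltW // c_gt0.
  - exact: u_gt0.
  - by rewrite divr_gt0 ?mulr_gt0 ?a_gt0.
  have u_neq0 j : u j != 0 by rewrite gt_eqF.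
  (* With this multiplier, the pivot relation is the recurrence at [i.+1] divided by [u i.+1]. *)
  have -> : (if i is 0%N then u 0%N else a.[i%:R]) / e i = u i / u i.+1.
    case: i => [|i] //=; have a_neq0 : a.[i.+1%:R] != 0 by rewrite gt_eqF // a_gt0.
    by rewrite invf_div mulrCA invfM mulVKf.
  rewrite /e u_rec // mulrAC -mulrDl.
  by rewrite [u i * _]mulrC subrK mulfK.
have u_ge0 n : 0 <= u n.+1.
  have := leading_minor_ge0 n.+1 tM; rewrite leading_minor_M0 //.
  by rewrite pmulr_rge0 // prodr_gt0 // => i _; apply: a_gt0.
elim=> // n u_gt0; rewrite lt_neqAle u_ge0 andbT eq_sym; apply/eqP => u_eq0.
have := u_rec n.+1 isT; rewrite u_eq0 mulr0 sub0r => au.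
have : 0 <= a.[n.+1%:R] * u n.+2 by rewrite mulr_ge0 // ltW // a_gt0.
by rewrite au oppr_ge0 leNgt mulr_gt0 // c_gt0.
Qed.
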